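(* Let $E$ be a reflexive real Banach space whose norm is uniformly Gâteaux differentiable, and suppose that $E$ has the fixed point property for nonexpansive mappings. Let $C$ be a nonempty closed convex subset of $E$, $\{S_n\}_{n\in\mathbb N}$ a sequence of self-mappings of $C$, $T\colon C\to C$ a nonexpansive mapping, and $\{\alpha_n\}_{n\in\mathbb N}$ a sequence in $(0,1]$. Suppose that $\alpha_n\to 0$, $\sum_{n=1}^\infty\alpha_n=\infty$, $\{S_n\}$ is a strongly nonexpansive sequence, and $\{S_n\}$ satisfies the NST condition (I) with $T$. Let $Q$ be the sunny nonexpansive retraction of $C$ onto $\mathrm F(T)$. Let $\{f_n\}_{n\in\mathbb N}$ be a sequence of self-mappings of $C$ and $\{y_n\}$ the sequence defined by $y_1\in C$ (arbitrary) and $$y_{n+1}=\alpha_nf_n(y_n)+(1-\alpha_n)S_ny_n\qquad(n\in\mathbb N).$$ Suppose that, for some $\theta\in[0,1)$, each $f_n$ is a $\theta$-contraction with respect to $\mathrm F(\{S_n\})$, and that there exists $u\in C$ such that $f_n(Qu)\to u$. Then $\{y_n\}$ converges strongly (i.e. in norm) to $Qu$.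
   Context: $\mathbb N$ is the set of positive integers. For a mapping $T\colon C\to E$ with $C\subset E$, $\mathrm F(T)=\{x\in C: Tx=x\}$; for a sequence $\{S_n\}$ of mappings $C\to E$, $\mathrm F(\{S_n\})=\bigcap_{n=1}^\infty \mathrm F(S_n)$. $T$ is nonexpansive if $\|Tx-Ty\|\le\|x-y\|$ for all $x,y\in C$. For a nonempty subset $F$ of $C$ and $\theta\in[0,1)$, a mapping $f\colon C\to C$ is a $\theta$-contraction with respect to $F$ if $\|f(x)-f(y)\|\le\theta\|x-y\|$ for all $x\in C$ and $y\in F$. With $U_E=\{x\in E:\|x\|=1\}$, the norm of $E$ is uniformly Gâteaux differentiable if for each $y\in U_E$ the limit $\lim_{t\to0}(\|x+ty\|-\|x\|)/t$ exists for all $x\in U_E$ and is attained uniformly for $x\in U_E$. $E$ has the fixed point property for nonexpansive mappings if every nonexpansive self-mapping of a nonempty bounded closed convex subset $D$ of $E$ has a fixed point in $D$. $\{S_n\}$ (mappings $C\to E$) is a strongly nonexpansive sequence if each $S_n$ is nonexpansive and $x_n-y_n-(S_nx_n-S_ny_n)\to0$ whenever $\{x_n\},\{y_n\}$ are sequences in $C$ such that $\{x_n-y_n\}$ is bounded and $\|x_n-y_n\|-\|S_nx_n-S_ny_n\|\to0$. $\{S_n\}$ satisfies the NST condition (I) with a mapping $T\colon C\to E$ if $\mathrm F(\{S_n\})\neq\emptyset$, $\mathrm F(T)\subset\mathrm F(\{S_n\})$, and $x_n-Tx_n\to0$ whenever $\{x_n\}$ is a bounded sequence in $C$ with $x_n-S_nx_n\to0$.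 (This forces $\mathrm F(T)=\mathrm F(\{S_n\})$.) For nonempty $K\subset C$, a mapping $Q$ of $C$ onto $K$ is a retraction if $Qx=x$ for all $x\in K$; it is sunny if $Q(Qx+\lambda(x-Qx))=Qx$ whenever $x\in C$, $\lambda\ge0$ and $Qx+\lambda(x-Qx)\in C$. A sunny nonexpansive retraction is a retraction that is sunny and nonexpansive. It is known that, when $E$ is a reflexive real Banach space whose norm is uniformly Gâteaux differentiable, $E$ has the fixed point property for nonexpansive mappings, and $C$ is a nonempty closed convex subset of $E$, for a nonexpansive self-mapping $T$ of $C$ with $\mathrm F(T)\ne\emptyset$ there is a unique sunny nonexpansive retraction of $C$ onto $\mathrm F(T)$. *)

(* Defs.v *)
From HB Require Import structures.
From mathcomp Require Import all_boot all_order all_algebra.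
From mathcomp Require Import all_classical all_reals all_analysis.

Import Order.TTheory GRing.Theory Num.Theory.
Import numFieldNormedType.Exports.

Local Open Scope classical_set_scope.
Local Open Scope ring_scope.

(* A mapping C -> E with C a subset of E is represented by a total function
   E -> E, of which only the values on C are ever used.  Sequences indexed by
   the positive integers are represented by functions on nat, the term of
   index n.+1 being the value at n. *)

Section space.
Context {R : realType} (E : normedModType R).

Definition dual_space : set (E -> R^o) :=
  [set f : E -> R^o | linear f /\ continuous f].

Definition dual_norm (f : E -> R^o) : R :=
  sup [set `|f x| | x in [set x : E | `|x| <= 1]].

(* Only the values of phi on dual_space matter: these phi are the bounded
   linear functionals on the normed space (dual_space, dual_norm). *)
Definition bidual_space : set ((E -> R^o) -> R) :=
  [set phi : (E -> R^o) -> R |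
    (forall (a : R) (f g : E -> R^o), dual_space f -> dual_space g ->
       phi (a *: f + g) = a * phi f + phi g) /\
    exists M : R, forall f : E -> R^o, dual_space f ->
      `|phi f| <= M * dual_norm f].

(* Surjectivity of the canonical embedding of E into its bidual. *)
Definition reflexive_space : Prop :=
  forall phi : (E -> R^o) -> R, bidual_space phi ->
    exists x : E, forall f : E -> R^o, dual_space f -> phi f = f x.

Definition unit_sphere : set E := [set x : E | `|x| = 1].

(* The limit is uniform in x, for each direction y separately. *)
Definition uniformly_Gateaux_differentiable_norm : Prop :=
  forall y : E, unit_sphere y ->
    exists g : E -> R,
      {uniform unit_sphere,
        (fun (t : R) (x : E) => (`|x + t *: y| - `|x|) / t) @ 0^' --> g}.

End space.

Section mappings.
Context {R : realType} {E : normedModType R}.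
Implicit Types (C F K : set E) (T f Q : E -> E) (S : nat -> E -> E).

Definition fixed_points C T : set E := [set x | C x /\ T x = x].

Definition common_fixed_points C S : set E := \bigcap_n fixed_points C (S n).

Definition nonexpansive C T : Prop :=
  forall x y : E, C x -> C y -> `|T x - T y| <= `|x - y|.

Definition contraction_wrt C F (theta : R) f : Prop :=
  forall x y : E, C x -> F y -> `|f x - f y| <= theta * `|x - y|.

Definition strongly_nonexpansive_seq C S : Prop :=
  (forall n, nonexpansive C (S n)) /\
  (forall x y : nat -> E,
     (forall n, C (x n)) -> (forall n, C (y n)) ->
     bounded_fun (fun n => x n - y n) ->
     (`|x n - y n| - `|S n (x n) - S n (y n)|) @[n --> \oo] --> (0 : R) ->
     (x n - y n - (S n (x n) - S n (y n))) @[n --> \oo] --> (0 : E)).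

Definition NST_condition_I C S T : Prop :=
  [/\ common_fixed_points C S !=set0,
      fixed_points C T `<=` common_fixed_points C S &
      forall x : nat -> E,
        (forall n, C (x n)) -> bounded_fun x ->
        (x n - S n (x n)) @[n --> \oo] --> (0 : E) ->
        (x n - T (x n)) @[n --> \oo] --> (0 : E)].

Definition retraction C K Q : Prop :=
  Q @` C = K /\ forall x, K x -> Q x = x.

Definition sunny C Q : Prop :=
  forall (x : E) (lambda : R), C x -> 0 <= lambda ->
    C (Q x + lambda *: (x - Q x)) -> Q (Q x + lambda *: (x - Q x)) = Q x.

Definition sunny_nonexpansive_retraction C K Q : Prop :=
  [/\ retraction C K Q, sunny C Q & nonexpansive C Q].

End mappings.

Definition fixed_point_property {R : realType} (E : normedModType R) : Prop :=
  forall D : set E,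
    D !=set0 -> bounded_set D -> closed D -> @convex_set R E D ->
    forall T : E -> E, set_fun D D T -> nonexpansive D T ->
      fixed_points D T !=set0.

(* Main.v *)
Require Import Defs.
From HB Require Import structures.
From mathcomp Require Import all_boot all_order all_algebra.
From mathcomp Require Import all_classical all_reals all_analysis.
From mathcomp Require Import ring lra.

Import Order.TTheory GRing.Theory Num.Theory.
Import numFieldNormedType.Exports.

Local Open Scope classical_set_scope.
Local Open Scope ring_scope.

(** Fix a selection [J] of the duality map, given by Hahn-Banach.  Uniform
Gateaux differentiability says that [`|a - l *: v| ^+ 2] is at most
[`|a| ^+ 2 - 2 * l * J a v + l * e] for all small [l > 0], uniformly for [a] in
a ball; hence [J a v] is uniformly continuous in [a] on balls.

Let [p = Q u] and let [z_t = t *: u + (1 - t) *: T z_t].  The asymptotic centre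
of a sequence [z_t] with [t --> 0] is nonempty by reflexivity and [T]-invariant,
so it contains a fixed point [q] of [T]; comparing [q] with
[q + l *: (u - q)] shows that the asymptotic radius is 0, so [z_t --> q], and
the variational inequality for [Q] gives [q = p].  Comparing with [z_t] then
yields [J (w - p) (u - p) <= e] for every [w] in a given bounded set for which
[`|w - T w|] is small.

With [s_n = `|y_n - p| ^+ 2] and [c = 1 - theta], the recursion gives
[s_(n+1) <= (1 - c * alpha_n) * s_n + 2 * alpha_n * e] as soon as
[J (y_(n+1) - p) (u - p)] is nearly nonpositive.  Either [`|y_n - p|] decreases
by a fixed amount, and the inequality holds because [alpha_n --> 0], or it
almost does not decrease, and then strong nonexpansiveness and the NST condition
make [y_n - T y_n] small.  So the inequality holds for all large [n], and
[s_n --> 0] because [alpha] is not summable. *)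

(** * Hahn-Banach theorem *)

Section hahn_banach.
Context {R : realType} {E : lmodType R}.
Implicit Types q : E -> R.

(** Homogeneity asks for one inequality only; the converse follows in [sublinearZ_ge], so an infimum
    has less to satisfy. *)
Definition sublinear q : Prop :=
  (forall c v, 0 <= c -> q (c *: v) <= c * q v) /\
  (forall v w, q (v + w) <= q v + q w).

Lemma sublinear0_ge0 q : sublinear q -> 0 <= q 0.
Proof. by case=> _ /(_ 0 0); rewrite addr0; lra. Qed.

Lemma sublinear_ge_opp q v : sublinear q -> - q (- v) <= q v.
Proof.
by move=> sq; have := sublinear0_ge0 _ sq; have := sq.2 v (- v); rewrite subrr; lra.
Qed.

Lemma sublinearZ_ge q c v : sublinear q -> 0 <= c -> c * q v <= q (c *: v).
Proof.
move=> sq; rewrite le_eqVlt => /predU1P[<-|c0].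
  by rewrite mul0r scale0r; exact: sublinear0_ge0.
have /(sq.1 _ (c *: v)) : 0 <= c^-1 by rewrite invr_ge0 ltW.
by rewrite scalerA mulVf ?gt_eqF// scale1r ler_pdivlMl.
Qed.

(** No single [G i] need be sublinear, since each inequality may pass to another index [k]. It
    serves for lowering along a direction, for chains in Zorn's lemma, and for separation. *)
Lemma directed_inf_sublinear (I : Type) (D : set I) (G : I -> E -> R) :
  D !=set0 ->
  (forall v, exists m, forall i, D i -> m <= G i v) ->
  (forall i c v, D i -> 0 <= c -> exists2 k, D k & G k (c *: v) <= c * G i v) ->
  (forall i j v w, D i -> D j ->
    exists2 k, D k & G k (v + w) <= G i v + G j w) ->
  exists2 q, sublinear q & forall i v, D i -> q v <= G i v.
Proof.
move=> [i0 Di0] Glb GZ GD.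
pose q v := inf [set G i v | i in D].
have qle i v : D i -> q v <= G i v.
  move=> Di; apply: ge_inf; last by exists i.
  by have [m mG] := Glb v; exists m => _ [j Dj <-]; exact: mG.
have qge v m : (forall i, D i -> m <= G i v) -> m <= q v.
  move=> mG; apply: lb_le_inf; first by exists (G i0 v), i0.
  by move=> _ [j Dj <-]; exact: mG.
exists q => //; split=> [c v c0|v w].
  have H i : D i -> q (c *: v) <= c * G i v.
    by move=> /GZ - /(_ c v c0)[k Dk]; apply: le_trans; exact: qle.
  move: c0; rewrite le_eqVlt => /predU1P[c0|c0].
    by have := H _ Di0; rewrite -c0 !mul0r.
  by rewrite -ler_pdivrMl//; apply: qge => i /H; rewrite ler_pdivrMl.
rewrite -lerBlDr; apply: (qge) => i Di; rewrite lerBlDr -lerBlDl.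
apply: qge => j Dj; rewrite lerBlDl.
by have [k Dk] := GD _ _ v w Di Dj; apply: le_trans; exact: qle.
Qed.

(** Take the infimum of [q (v + t *: x) - t * q x] over [t >= 0]: the term [t = 0] gives [q' <= q],
    the term [t = 1] the value at [- x]. A minimal sublinear functional equals each of its
    lowerings, which makes it odd. *)
Lemma sublinear_lower q x : sublinear q ->
  exists q', [/\ sublinear q', forall v, q' v <= q v & q' (- x) <= - q x].
Proof.
move=> sq.
have [||||q' sq' q'le] := @directed_inf_sublinear R [set t | 0 <= t]
  (fun t v => q (v + t *: x) - t * q x).
- by exists 0 => /=.
- move=> v; exists (- q (- v)) => t t0.
  have := sublinearZ_ge _ _ x sq t0.
  by have := sq.2 (v + t *: x) (- v); rewrite (addrAC v) subrr add0r; lra.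
- move=> t c v /= t0 c0; exists (c * t); first exact: mulr_ge0.
  rewrite -scalerA -scalerDr mulrBr mulrA lerB//. exact: sq.1.
- move=> t s v w /= t0 s0; exists (t + s); first exact: addr_ge0.
  have := sq.2 (v + t *: x) (w + s *: x).
  by rewrite scalerDl addrACA; lra.
exists q'; split => //.
  by move=> v; have := q'le 0 v (lexx _); rewrite scale0r addr0 mul0r subr0.
have := q'le 1 (- x) ler01; rewrite scale1r addNr mul1r.
by have := sq.1 0 0 (lexx _); rewrite scale0r mul0r; lra.
Qed.

Lemma minimal_sublinear q : sublinear q ->
  exists f, [/\ sublinear f, forall v, f v <= q v &
    forall g, sublinear g -> (forall v, g v <= f v) -> g = f].
Proof.
move=> sq.
pose P := {f : E -> R | sublinear f /\ forall v, f v <= q v}.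
(* The order is reversed: a maximal element for [le] is a minimal functional. *)
pose le (f g : P) := `[< forall v, sval g v <= sval f v >].
have [||||[f [sf fq]] fmin] := @Zorn P le.
- by move=> f; apply/asboolP => v.
- move=> f g h /asboolP fg /asboolP gh; apply/asboolP => v.
  exact: le_trans (gh v) (fg v).
- move=> [f Pf] [g Pg] /asboolP /= fg /asboolP /= gf; apply: eq_exist.
  by apply/funext => v; apply/eqP; rewrite eq_le fg gf.
- move=> A Atot; have [A0|/set0P/negP/negPn/eqP->] := pselect (A !=set0);
    last by exists (exist _ q (conj sq (fun v => lexx _))).
  have [|||g sg gle] := directed_inf_sublinear _ A (fun f => sval f) A0.
  + move=> v; exists (- q (- v)) => -[f [sf fq]] _ /=.
    apply: le_trans (sublinear_ge_opp _ v sf); rewrite lerN2; exact: fq.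
  + by move=> f c v Af c0; exists f => //; apply: (svalP f).1.1.
  + move=> f g v w Af Ag; have [/asboolP fg|/asboolP gf] := Atot _ _ Af Ag.
      exists g => //; apply: le_trans ((svalP g).1.2 _ _) _.
      by rewrite lerD2r.
    exists f => //; apply: le_trans ((svalP f).1.2 _ _) _.
    by rewrite lerD2l.
  have gq v : g v <= q v.
    by have [f Af] := A0; exact: le_trans (gle _ v Af) ((svalP f).2 v).
  by exists (exist _ g (conj sg gq)) => f Af; apply/asboolP => v /=; exact: gle.
exists f; split=> // g sg gf.
have gq v : g v <= q v by exact: le_trans (gf v) (fq v).
have /fmin/(congr1 sval) // : le (exist _ f (conj sf fq)) (exist _ g (conj sg gq)).
exact/asboolP.
Qed.

(** Lower [q] along [x] and take a minimal [f] below the result. Minimality makes [f] odd, an odd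
    sublinear functional is linear, and [f (- x) <= - q x] turns into [q x <= f x]. *)
Lemma hahn_banach_sublinear q x : sublinear q ->
  exists f : E -> R^o, [/\ linear f, forall v, f v <= q v & f x = q x].
Proof.
move=> sq; have [q1 [sq1 q1q q1x]] := sublinear_lower _ x sq.
have [f [sf fq1 fmin]] := minimal_sublinear _ sq1.
have fN v : f (- v) = - f v.
  have [g [sg gf gv]] := sublinear_lower _ v sf.
  apply/eqP; rewrite eq_le -{1}(fmin g sg gf) gv/=.
  by have := sublinear_ge_opp _ v sf; lra.
have fZ c v : 0 <= c -> f (c *: v) = c * f v.
  by move=> c0; apply/eqP; rewrite eq_le sf.1//= sublinearZ_ge.
have fD v w : f (v + w) = f v + f w.
  apply/eqP; rewrite eq_le sf.2/=.
  by have := sf.2 (v + w) (- w); rewrite addrK fN; lra.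
exists f; split.
- move=> c v w; rewrite fD; congr (_ + _).
  have [/fZ//|/ltW c0] := leP 0 c.
  by rewrite -[c]opprK scaleNr fN fZ ?oppr_ge0// -mulNr.
- by move=> v; exact: le_trans (fq1 v) (q1q v).
- apply/eqP; rewrite eq_le (le_trans (fq1 x) (q1q x))/=.
  by have := fq1 (- x); rewrite fN; lra.
Qed.

End hahn_banach.

Section convexity.
Context {R : realType} {E : normedModType R}.

Lemma convex_set_lmodP (A : set E) : @convex_set R E A <->
  forall (t : R) (x y : E), 0 <= t <= 1 -> A x -> A y ->
    A (t *: x + (1 - t) *: y).
Proof.
split=> [cA t x y /andP[t0 t1] Ax Ay|cA x y t].
  by have := cA x y (Itv01 t0 t1); rewrite !inE; exact.
rewrite !inE => Ax Ay; have t01 : 0 <= t%:num <= 1 by rewrite ge0/=.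
exact: (cA t%:num x y t01).
Qed.

End convexity.

(** * Dual space and separation from a closed convex set *)

Section dual.
Context {R : realType} {E : normedModType R}.
Implicit Types (K : set E) (f : E -> R^o).

Lemma linear_sub f x y : linear f -> f (x - y) = f x - f y.
Proof. by move=> lf; rewrite addrC -scaleN1r lf scaleN1r addrC. Qed.

Lemma linear0_eq f : linear f -> f 0 = 0.
Proof. by move=> lf; rewrite -(subrr 0) linear_sub// subrr. Qed.

Lemma linear_opp f x : linear f -> f (- x) = - f x.
Proof. by move=> lf; rewrite -(sub0r x) linear_sub// linear0_eq// sub0r. Qed.

Lemma linear_scale f a x : linear f -> f (a *: x) = a * f x.
Proof. by move=> lf; rewrite -[a *: x]addr0 lf linear0_eq// addr0. Qed.

Lemma linear_add f x y : linear f -> f (x + y) = f x + f y.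
Proof. by move=> lf; have := lf 1 x y; rewrite !scale1r. Qed.

Lemma linear_norm_le f v : linear f -> (forall v, f v <= `|v|) -> `|f v| <= `|v|.
Proof.
move=> lf fle; rewrite ler_norml fle andbT lerNl -linear_opp// -normrN.
exact: fle.
Qed.

Lemma dominated_dual f : linear f -> (forall v, f v <= `|v|) -> dual_space E f.
Proof.
move=> lf fle; split=> // x; apply/(@cvgrPdist_le _ R^o) => e e0.
near=> y; rewrite -linear_sub//; apply: le_trans (linear_norm_le _ _ lf fle) _.
near: y; exact: cvgr_dist_le.
Unshelve. all: end_near. Qed.

Lemma dual_bounded f : dual_space E f -> exists M, forall x, `|f x| <= M * `|x|.
Proof.
move=> [lf cf].
pose g : {linear E -> R^o} :=
  HB.pack f (GRing.isLinear.Build R E R^o *:%R f lf).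
have /linear_boundedP bg : bounded_near g (nbhs 0).
  exact: (proj2 (linear_bounded_continuous g)).
near +oo_R => M; exists M; near: M; exact: bg.
Unshelve. all: end_near. Qed.

Lemma dual_norm_ub f x : dual_space E f -> `|x| <= 1 -> `|f x| <= dual_norm E f.
Proof.
move=> /dual_bounded[M fM] x1; apply: ub_le_sup; last by exists x.
exists `|M| => _ [y /= y1 <-]; apply: le_trans (fM y) _.
apply: le_trans (ler_norm _) _; rewrite normrM normr_id.
by rewrite ler_piMr.
Qed.

Lemma dual_norm_ge0 f : dual_space E f -> 0 <= dual_norm E f.
Proof.
move=> df; apply: le_trans (dual_norm_ub _ 0 df _) => //.
by rewrite normr0.
Qed.

Lemma le_dual_norm f x : dual_space E f -> `|f x| <= dual_norm E f * `|x|.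
Proof.
move=> df; have [->|x0] := eqVneq x 0.
  by rewrite (linear0_eq _ df.1) !normr0 mulr0.
have nx : 0 < `|x| by rewrite normr_gt0.
rewrite -ler_pdivrMr// -[leLHS]mulrC -[X in X * _]ger0_norm ?invr_ge0//.
rewrite -normrM -(linear_scale _ _ _ df.1); apply: dual_norm_ub => //.
by rewrite normrZ normfV normr_id mulVf ?gt_eqF.
Qed.

(* The functional is a subgradient at [x] of the distance to [K]: the infimum
   below is the positively homogeneous hull of [v |-> dist (x + v) K - d], in
   which [a] is the inverse of the step. *)
Lemma hahn_banach_separation K x : K !=set0 -> closed K -> @convex_set R E K ->
  ~ K x -> exists2 f, dual_space E f &
    exists2 d, 0 < d & forall k, K k -> f k <= f x - d.
Proof.
move=> [k0 Kk0] clK /convex_set_lmodP cK nKx.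
have [d d0 dK] : exists2 d, 0 < d & forall k, K k -> d <= `|x - k|.
  have : nbhs x (~` K) by apply: open_nbhs_nbhs; split => //; exact: closed_openC.
  move=> /nbhs_ballP[d /= d0 dK]; exists d => // k Kk; rewrite leNgt.
  by apply/negP => xk; apply: (dK k) => //; rewrite -ball_normE.
have [||||q sq qle] := @directed_inf_sublinear R E _
  [set ak : R * E | 0 <= ak.1 /\ K ak.2]
  (fun ak v => `|ak.1 *: (x - ak.2) + v| - ak.1 * d).
- by exists (0, k0).
- move=> v; exists (- `|v|) => -[a k] /= [a0 Kk].
  have := ler_normD (a *: (x - k) + v) (- v).
  rewrite addrK normrN normrZ ger0_norm//.
  by have := ler_wpM2l a0 (dK k Kk); lra.
- move=> [a k] c v /= [a0 Kk] c0; exists (c * a, k) => /=.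
    by split => //; exact: mulr_ge0.
  by rewrite -scalerA -scalerDr normrZ ger0_norm// -mulrA -mulrBr.
- move=> [a k] [b l] v w /= [a0 Kk] [b0 Kl].
  (* The convex weights [a / (a + b)] used below need [a + b != 0]. *)
  have [ab0|ab0] := eqVneq (a + b) 0.
    have [-> ->] : a = 0 /\ b = 0 by split; lra.
    exists (0, k) => //=; rewrite !mul0r !scale0r !add0r !subr0.
    exact: ler_normD.
  have ab : 0 < a + b by rewrite lt_neqAle eq_sym ab0 addr_ge0.
  exists (a + b, (a / (a + b)) *: k + (1 - a / (a + b)) *: l) => /=.
    split; first exact: addr_ge0.
    apply: cK => //; rewrite divr_ge0 ?(ltW ab)//=.
    by rewrite ler_pdivrMr// mul1r lerDl.
  have -> : (a + b) *: (x - (a / (a + b) *: k + (1 - a / (a + b)) *: l)) =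
     a *: (x - k) + b *: (x - l).
    rewrite !scalerBr scalerDr !scalerA [(a + b) * (a / _)]mulrC divfK//.
    rewrite mulrBr mulr1 [(a + b) * (a / _)]mulrC divfK// addrAC subrr add0r.
    by rewrite scalerDl opprD addrACA.
  rewrite addrACA mulrDl opprD [leRHS]addrACA lerD2r; exact: ler_normD.
have [f [lf fq fx]] := hahn_banach_sublinear _ 0 sq.
have fle v : f v <= `|v|.
  apply: le_trans (fq v) _; have := qle (0, k0) v.
  by rewrite /= scale0r add0r mul0r subr0; apply.
exists f; first exact: dominated_dual.
exists d => // k Kk.
(* At the index [(1, k)] and [v = k - x] the norm vanishes and only [- d] is left. *)
have := le_trans (fq (k - x)) (qle (1, k) (k - x) (conj ler01 Kk)).
by rewrite /= scale1r subrKA subrr normr0 mul1r linear_sub//; lra.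
Qed.

End dual.

(** * Reflexivity *)

Section reflexivity.

Lemma ultra_fmap (T V : Type) (g : T -> V) (U : set_system T) :
  UltraFilter U -> UltraFilter (g @ U).
Proof.
move=> UU; split=> [|G GF sUG]; first exact: fmap_proper_filter.
apply/seteqP; split=> // A GA; rewrite /fmap/=.
have [//|UnA] := in_ultra_setVsetC (g @^-1` A) UU.
have /(filterI GA) : G (~` A) by exact: sUG.
by rewrite setICr => /filter_not_empty.
Qed.

Lemma bounded_ultra_cvg (R : realType) (T : Type) (U : set_system T)
    (g : T -> R) (B : R) :
  UltraFilter U -> (forall t, `|g t| <= B) -> exists l : R, g t @[t --> U] --> l.
Proof.
move=> UU gB; have := @segment_compact R (- B) B; rewrite compact_ultra.
have UgU := ultra_fmap _ _ g _ UU.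
move=> /(_ (g @ U) UgU)[|l [_ gl]]; last by exists l.
by rewrite /fmap/=; apply: filterE => t; rewrite /= in_itv/= -ler_norml.
Qed.

Context {R : realType} {E : normedModType R}.

(* A weak cluster point of a selection from the sets, taken along an
   ultrafilter and realised in E by reflexivity, lies in all of them. *)
Lemma reflexive_bigcap_neq0 (K : nat -> set E) : reflexive_space E ->
  (forall n, K n !=set0) -> bounded_set (K 0) ->
  (forall n, closed (K n)) -> (forall n, @convex_set R E (K n)) ->
  (forall m n, (m <= n)%N -> K n `<=` K m) ->
  \bigcap_n K n !=set0.
Proof.
move=> rE K0 bK clK cK decrK.
have /choice[x Kx] : forall n, exists y, K n y by exact: K0.
have [M xM] : exists M, forall n, `|x n| <= M.
  near +oo_R => M; exists M => n.
  suff: forall y, K 0%N y -> `|y| <= M by apply; exact: (decrK 0%N n).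
  near: M; exact: bK.
have M0 : 0 <= M by exact: le_trans (xM 0%N).
have [U [UU ooU]] := ultraFilterLemma (F := \oo : set_system nat) _.
have fM (f : E -> R^o) n : dual_space E f -> `|f (x n)| <= M * dual_norm E f.
  move=> df; apply: le_trans (le_dual_norm _ _ df) _; rewrite mulrC ler_wpM2r//.
  exact: dual_norm_ge0.
(* [phi f] is the limit along [U]; outside the dual space the value 0 is a placeholder. *)
have /choice[phi phiP] : forall f : E -> R^o, exists l : R,
    dual_space E f -> f (x n) @[n --> U] --> l.
  move=> f; have [df|] := pselect (dual_space E f); last by exists 0.
  have [l fl] := bounded_ultra_cvg R nat U (f \o x) _ UU (fun n => fM f n df).
  by exists l.
have [|p phip] := rE phi.
  split=> [a f g df dg|].
    have dfg : dual_space E (a *: f + g).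
      have [[lf cf] [lg cg]] := (df, dg); split.
        move=> c v w; rewrite !fctE !lf !lg !scalerDr !scalerA (mulrC c).
        exact: addrACA.
      move=> v; apply: (@cvgD _ R^o); last exact: cg.
      by apply: (@cvgZr _ R^o); exact: cf.
    apply: (cvg_unique _ (phiP _ dfg)) => //.
    by apply: cvgD; [apply: cvgMr; exact: phiP|exact: phiP].
  exists M => f df; rewrite ler_norml; apply/andP; split.
    apply: (cvgr_to_ge (phiP f df)); apply: filterE => n.
    by have := fM f n df; rewrite ler_norml => /andP[].
  apply: (cvgr_to_le (phiP f df)); apply: filterE => n.
  exact: le_trans (ler_norm _) (fM f n df).
(* If [p] missed [K m], a separating [f] would keep [f (x n)] at most [f p - d] for all [n >= m],
   and so would its limit [phi f], which equals [f p]. *)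
exists p => m _; apply: contrapT => nKp.
have [f df [d d0 fKd]] := hahn_banach_separation _ _ (K0 m) (clK m) (cK m) nKp.
suff : phi f <= f p - d by rewrite phip//; lra.
apply: (cvgr_to_le (phiP f df)); apply: ooU; exists m => // n mn /=.
by apply: fKd; exact: (decrK m n).
Unshelve. all: end_near. Qed.

End reflexivity.

(** * Duality map *)

Section duality.
Context {R : realType} {E : normedModType R}.
Implicit Types (J : E -> E -> R^o) (a b v x : E).

Definition duality_selection J : Prop :=
  forall x, [/\ linear (J x), J x x = `|x| ^+ 2 & forall v, J x v <= `|x| * `|v|].

(** Dominate by the norm scaled by that of [x], with equality at [x] itself. *)
Lemma duality_selection_exists : exists J, duality_selection J.
Proof.
have /choice[J HJ] : forall x, exists f : E -> R^o,
    [/\ linear f, f x = `|x| ^+ 2 & forall v, f v <= `|x| * `|v|].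
  move=> x; have [|f [lf fle fx]] :=
      hahn_banach_sublinear (fun v : E => `|x| * `|v|) x.
    split=> [c v c0|v w]; first by rewrite normrZ ger0_norm// mulrCA.
    by rewrite -mulrDr ler_wpM2l// ler_normD.
  by exists f; split => //; rewrite fx expr2.
by exists J.
Qed.

(** Adding the difference quotients at [t] and [- t] cancels the limit [g]. The direction is
    normalised, so [t] is [l] times the norm of [v]. *)
Lemma smooth_symmetric_quotient v e :
  uniformly_Gateaux_differentiable_norm E -> 0 < e ->
  exists2 l0, 0 < l0 & forall l x, 0 < l <= l0 -> `|x| = 1 ->
    `|x + l *: v| + `|x - l *: v| - 2 <= e * l.
Proof.
move=> smooth e0; have [->|v0] := eqVneq v 0.
  exists 1 => // l x /andP[l0 _] x1; rewrite scaler0 subr0 addr0 x1.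
  by have := mulr_gt0 e0 l0; lra.
have nv : 0 < `|v| by rewrite normr_gt0.
have [|g] := smooth (`|v|^-1 *: v).
  by rewrite /unit_sphere/= normrZ normfV normr_id mulVf ?gt_eqF.
pose e' := e / (2 * `|v|); have e'0 : 0 < e' by rewrite divr_gt0// mulr_gt0.
move=> gcvg; have : \forall t \near (0 : R)^', forall x, `|x| = 1 ->
    `|g x - (`|x + t *: (`|v|^-1 *: v)| - `|x|) / t| < e'.
  pose P : set (E -> R) := [set h | forall x, `|x| = 1 -> `|g x - h x| < e'].
  apply: (gcvg P); apply/(@uniform_nbhs E _ R).
  exists [set uv : R * R | ball uv.1 e' uv.2]; split; last by [].
  exact: (entourage_ball R (PosNum e'0)).
(* The factor 2 makes [t < d] strict, as the open ball demands. *)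
move=> /nbhs_ballP[d /= d0 Hd]; exists (d / (2 * `|v|)).
  by rewrite divr_gt0// mulr_gt0.
move=> l x /andP[l0 ld] x1; pose t := l * `|v|.
have t0 : 0 < t by rewrite mulr_gt0.
have td : t < d.
  move: ld; rewrite ler_pdivlMr ?mulr_gt0// mulrCA -/t => td.
  by apply: lt_le_trans td; rewrite ltr_pMl// ltr1n.
have tv : t *: (`|v|^-1 *: v) = l *: v by rewrite scalerA mulfK ?gt_eqF.
have := Hd t; rewrite /ball/= sub0r normrN gtr0_norm// => /(_ td).
rewrite gt_eqF// => /(_ isT _ x1); rewrite tv x1 => H1.
have := Hd (- t); rewrite /ball/= sub0r opprK gtr0_norm// => /(_ td).
rewrite oppr_eq0 gt_eqF// => /(_ isT _ x1); rewrite scaleNr tv x1 => H2.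
have : (`|x + l *: v| - 1) / t + (`|x - l *: v| - 1) / t <= 2 * e'.
  move: H1 H2; rewrite invrN mulrN !ltr_norml => /andP[H1 H2] /andP[H3 H4]; lra.
rewrite -mulrDl ler_pdivrMr// (_ : 2 * e' * t = e * l); first by lra.
by rewrite /e' /t; field; rewrite gt_eqF.
Qed.

Section selection.
Variables (J : E -> E -> R^o) (HJ : duality_selection J).

(** [J a (a + v)] is at most the product of the norms of [a] and [a + v], hence at most half the sum
    of their squares. *)
Lemma duality_subgradient a v : `|a| ^+ 2 + 2 * J a v <= `|a + v| ^+ 2.
Proof.
have [lJ Jaa Jle] := HJ a; have := Jle (a + v).
rewrite (linear_add _ _ _ lJ) Jaa.
by have := sqr_ge0 (`|a| - `|a + v|); lra.
Qed.

Hypothesis smooth : uniformly_Gateaux_differentiable_norm E.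

(** By the subgradient inequality at [l *: v] it suffices to bound the sum of the squared norms of
    [a - l *: v] and [a + l *: v]. When [a] has norm at most [r] the triangle inequality is enough;
    otherwise [a] is rescaled to the unit sphere, where smoothness applies. *)
Lemma duality_upper_expansion v M e : 0 < e ->
  exists2 l0, 0 < l0 & forall l a, 0 < l <= l0 -> `|a| <= M ->
    `|a - l *: v| ^+ 2 <= `|a| ^+ 2 - 2 * l * J a v + l * e.
Proof.
move=> e0; pose M' := `|M| + 1; have M'0 : 0 < M' by rewrite ltr_wpDl.
pose V := `|v| + 1; have V0 : 0 < V by rewrite ltr_wpDl.
pose r := e / (8 * V); have r0 : 0 < r by rewrite divr_gt0// mulr_gt0.
pose e' := e / (4 * M'); have e'0 : 0 < e' by rewrite divr_gt0// mulr_gt0.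
have [k k0 Hk] := smooth_symmetric_quotient v e' smooth e'0.
pose m := e / (4 * V ^+ 2).
have m0 : 0 < m by rewrite divr_gt0// mulr_gt0// exprn_gt0.
(* [m] controls the terms quadratic in [l]; [k * r] keeps the rescaled step at most [k] once the
   norm of [a] exceeds [r]. *)
exists (Num.min m (k * r)); first by rewrite lt_min m0 mulr_gt0.
move=> l a; rewrite le_min => /andP[l0 /andP[lm lkr]] aM.
suff H : `|a - l *: v| ^+ 2 + `|a + l *: v| ^+ 2 <= 2 * `|a| ^+ 2 + l * e.
  have := duality_subgradient a (l *: v).
  by have [lJ _ _] := HJ a; rewrite (linear_scale _ _ _ lJ); lra.
have lv0 : 0 <= l * `|v| by rewrite mulr_ge0// ltW.
have nlv : `|l *: v| = l * `|v| by rewrite normrZ gtr0_norm.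
have lv2 : 2 * (l * `|v|) ^+ 2 <= l * e / 2.
  have : l * `|v| ^+ 2 <= m * V ^+ 2.
    by rewrite ler_pM ?(ltW l0)// ?ler_pXn2r ?nnegrE ?(ltW V0)// lerDl.
  have -> : m * V ^+ 2 = e / 4 by rewrite /m; field; rewrite gt_eqF.
  move=> H.
  by have := ler_wpM2l (ltW l0) H; lra.
have up w : `|w| = l * `|v| -> `|a + w| <= `|a| + l * `|v|.
  by move=> <-; exact: ler_normD.
have dn w : `|w| = l * `|v| -> `|a| - l * `|v| <= `|a + w|.
  by move=> <-; rewrite lerBlDr -{1}(addrK w a) -[`|w|]normrN; exact: ler_normD.
have P1 := up _ nlv; have P2 := dn _ nlv.
rewrite -normrN in nlv; have N1 := up _ nlv; have N2 := dn _ nlv.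
have {up dn} := normr_ge0 (a - l *: v); have := normr_ge0 (a + l *: v).
set P := `|a + l *: v| in P1 P2 *; set N := `|a - l *: v| in N1 N2 * => P0 N0.
have [ar|ra] := leP `|a| r.
  have Pl : P ^+ 2 <= (`|a| + l * `|v|) ^+ 2 by rewrite ler_pXn2r ?nnegrE// addr_ge0.
  have Nl : N ^+ 2 <= (`|a| + l * `|v|) ^+ 2 by rewrite ler_pXn2r ?nnegrE// addr_ge0.
  have : `|a| * `|v| <= e / 8.
    have -> : e / 8 = r * V by rewrite /r; field; rewrite gt_eqF.
    by rewrite ler_pM// lerDl.
  by move/(ler_wpM2l (ltW l0)); nra.
have a0 : 0 < `|a| by exact: lt_trans ra.
have : P + N <= 2 * `|a| + e' * l.
  have E1 w : `|a|^-1 *: a + (l / `|a|) *: w = `|a|^-1 *: (a + l *: w).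
    by rewrite scalerDr scalerA mulrC.
  have lk : 0 < l / `|a| <= k.
    rewrite divr_gt0//= ler_pdivrMr//; apply: le_trans lkr _.
    by rewrite ler_pM2l// ltW.
  have := Hk (l / `|a|) (`|a|^-1 *: a) lk.
  rewrite -scalerN !E1 scalerN !normrZ normfV normr_id mulVf ?gt_eqF//.
  move=> /(_ erefl)/(ler_wpM2l (ltW a0)).
  rewrite -/P -/N (_ : `|a| * (e' * (l / `|a|)) = e' * l); last first.
    by field; rewrite gt_eqF.
  rewrite (_ : `|a| * (`|a|^-1 * P + `|a|^-1 * N - 2) = P + N - 2 * `|a|).
    by lra.
  by field; rewrite gt_eqF.
have ae' : `|a| * e' <= e / 4.
  have -> : e / 4 = M' * e' by rewrite /e'; field; rewrite gt_eqF.
  by rewrite ler_pM2r//; apply: le_trans aM _; rewrite (le_trans (ler_norm M))// lerDl.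
(* Expand [P ^+ 2] and [N ^+ 2] about the norm of [a]: the linear parts combine into the bound on
   [P + N], and the remainders are at most [(l * |v|) ^+ 2] each. *)
move/(ler_wpM2l (ltW a0)).
have : (P - `|a|) ^+ 2 <= (l * `|v|) ^+ 2 by nra.
have : (N - `|a|) ^+ 2 <= (l * `|v|) ^+ 2 by nra.
by have := ler_wpM2l (ltW l0) ae'; lra.
Qed.

(** For a fixed step [l], combine the subgradient inequality at [a] with the upper expansion at [b].
    What remains are differences of squared norms, of the order of the norm of [a - b]; as [l] is
    chosen before [d], they are at most [l * e]. *)
Lemma duality_uniformly_continuous v M e : 0 < e ->
  exists2 d, 0 < d & forall a b, `|a| <= M -> `|b| <= M -> `|a - b| <= d ->
    J a v <= J b v + e.
Proof.
move=> e0; have [l l0 Hl] := duality_upper_expansion (- v) M e e0.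
(* [B] adds the Lipschitz constants of the two differences of squares below; the final 1 makes it
   positive. *)
pose B := 4 * `|M| + 2 * l * `|v| + 1.
have lv0 : 0 <= l * `|v| by rewrite mulr_ge0// ltW.
have M0 := normr_ge0 M; have B0 : 0 < B by rewrite /B; lra.
exists (l * e / B); first by rewrite divr_gt0// mulr_gt0.
move=> a b aM bM; rewrite ler_pdivlMr// => abd.
have := Hl l b; rewrite lexx l0/= => /(_ isT bM).
have [lJ _ _] := HJ b; rewrite (linear_opp _ _ lJ) scalerN opprK.
have := duality_subgradient a (l *: v).
have [lJa _ _] := HJ a; rewrite (linear_scale _ _ _ lJa).
have MM := ler_norm M.
have Bab : `|b| ^+ 2 - `|a| ^+ 2 <= `|a - b| * (2 * `|M|).
  have : `|b| <= `|a - b| + `|a|.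
    by rewrite distrC -{1}(subrK a b); exact: ler_normD.
  by have := normr_ge0 a; have := normr_ge0 b; have := normr_ge0 (a - b); nra.
have : `|a + l *: v| ^+ 2 - `|b + l *: v| ^+ 2 <=
    `|a - b| * (2 * `|M| + 2 * (l * `|v|)).
  have : `|a + l *: v| <= `|a - b| + `|b + l *: v|.
    by apply: le_trans (ler_normD _ _); rewrite addrA subrK.
  have : `|a + l *: v| <= `|a| + l * `|v|.
    by apply: le_trans (ler_normD _ _) _; rewrite normrZ gtr0_norm.
  have : `|b + l *: v| <= `|b| + l * `|v|.
    by apply: le_trans (ler_normD _ _) _; rewrite normrZ gtr0_norm.
  have := normr_ge0 (a + l *: v); have := normr_ge0 (b + l *: v).
  have := normr_ge0 (a - b).
  set X := `|a + _ *: _|; set Y := `|b + _ *: _|; set D := `|a - b|.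
  move=> D0 Y0 X0 Yb Xa XY; rewrite subr_sqr.
  have [XltY|YX] := leP X Y.
    have : (X - Y) * (X + Y) <= 0 by rewrite mulr_le0_ge0 ?subr_le0 ?addr_ge0.
    have : 0 <= D * (2 * `|M| + 2 * (l * `|v|)) by rewrite mulr_ge0//; lra.
    by move=> H1 H2; exact: le_trans H2 H1.
  by apply: ler_pM; lra.
move=> H1 H2 H3; have := normr_ge0 (a - b) => H4.
suff : l * (J a v) <= l * (J b v + e) by rewrite ler_pM2l.
by move: abd; rewrite /B; nra.
Qed.

End selection.

End duality.

(** * The variational inequality of a sunny nonexpansive retraction *)

Section sunny_retraction.
Context {R : realType} {E : normedModType R}.
Variables (J : E -> E -> R^o) (HJ : duality_selection J).
Hypothesis smooth : uniformly_Gateaux_differentiable_norm E.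

(** [Q] sends [Q x + m *: v] to [Q x], so by nonexpansiveness [a - m *: v] is no shorter than [a]. A
    positive [J a v] would make it strictly shorter by the upper expansion. *)
Lemma sunny_retraction_variational (C K : set E) (Q : E -> E) (x q : E) :
  @convex_set R E C -> K `<=` C -> sunny_nonexpansive_retraction C K Q ->
  C x -> K q -> J (q - Q x) (x - Q x) <= 0.
Proof.
move=> /convex_set_lmodP cC KC [[QCK QK] sunQ nQ] Cx Kq; rewrite leNgt.
apply/negP => Jpos; set a := q - Q x in Jpos *; set v := x - Q x in Jpos *.
have [l l0 Hl] := duality_upper_expansion J HJ smooth v `|a| _ Jpos.
(* [m <= 1] keeps [Q x + m *: v] on the segment from [Q x] to [x], hence in [C]. *)
pose m := Num.min l 1.
have m0 : 0 < m by rewrite lt_min l0 ltr01.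
have [ml m1] : m <= l /\ m <= 1 by split; rewrite ge_min lexx// orbT.
have := Hl m a; rewrite m0 ml/= => /(_ isT (lexx _)) Hm.
have CQx : C (Q x) by apply: KC; rewrite -QCK; exists x.
have Cm : C (Q x + m *: v).
  have -> : Q x + m *: v = m *: x + (1 - m) *: Q x.
    by rewrite scalerBr scalerBl scale1r addrCA.
  by apply: cC => //; rewrite ltW.
have : `|a| <= `|a - m *: v|.
  have := nQ q _ (KC _ Kq) Cm.
  by rewrite sunQ ?(ltW m0)// QK// -/a opprD addrA.
move=> aa; have : `|a| ^+ 2 <= `|a - m *: v| ^+ 2 by rewrite ler_pXn2r ?nnegrE.
by have := mulr_gt0 m0 Jpos; lra.
Qed.

End sunny_retraction.

(** * Resolvents and asymptotic centres *)

Section resolvent.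
Context {R : realType}.

(** Banach's fixed point theorem for a contraction of factor [1 - t]. *)
Lemma resolvent_exists (E : completeNormedModType R) (C : set E) (T : E -> E)
    (u : E) (t : R) :
  closed C -> @convex_set R E C -> set_fun C C T -> nonexpansive C T ->
  C u -> 0 < t <= 1 -> exists2 z, C z & z = t *: u + (1 - t) *: T z.
Proof.
move=> clC /convex_set_lmodP cC CT nT Cu /andP[t0 t1].
pose g x := t *: u + (1 - t) *: T x.
have gC : set_fun C C g.
  by move=> x Cx; apply: cC => //; [rewrite ltW|exact: CT].
have q0 : 0 <= 1 - t by rewrite subr_ge0.
have ctr : is_contraction (mkfun gC).
  exists (NngNum q0); split; first by rewrite /= ltrBlDr ltrDl.
  move=> [x y] [/= Cx Cy]; rewrite /g opprD addrACA subrr add0r -scalerBr.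
  by rewrite normrZ ger0_norm// ler_wpM2l// nT.
have [//||z Cz zg] := banach_fixed_point ctr; first by exists u.
by exists z.
Qed.

Context {E : normedModType R}.
Variables (C : set E) (T : E -> E) (u z q : E) (t : R).
Hypotheses (nT : nonexpansive C T) (t01 : 0 < t <= 1) (Cz : C z).
Hypotheses (zE : z = t *: u + (1 - t) *: T z) (Fq : fixed_points C T q).

Lemma resolvent_image_dist : `|T z - q| <= `|z - q|.
Proof. by have [Cq {1}<-] := Fq; exact: nT. Qed.

Let resolvent_sub : z - q = t *: (u - q) + (1 - t) *: (T z - q).
Proof.
rewrite [in LHS]zE !scalerBr addrACA -opprD -scalerDl.
by rewrite [t + _]addrC subrK scale1r.
Qed.

Lemma resolvent_dist : `|z - q| <= `|u - q|.
Proof.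
have /andP[t0 t1] := t01.
have : `|z - q| <= t * `|u - q| + (1 - t) * `|T z - q|.
  rewrite {1}resolvent_sub; apply: le_trans (ler_normD _ _) _.
  by rewrite !normrZ gtr0_norm// ger0_norm// subr_ge0.
have t1' : 0 <= 1 - t by rewrite subr_ge0.
have := ler_wpM2l t1' resolvent_image_dist => H1 H2.
by rewrite -(ler_pM2l t0); lra.
Qed.

(** Apply [J (z - q)] to the resolvent equation, absorb the term of factor [1 - t] into the left
    side and divide by [t]. *)
Lemma resolvent_variational (J : E -> E -> R^o) : duality_selection J ->
  `|z - q| ^+ 2 <= J (z - q) (u - q).
Proof.
move=> HJ; have /andP[t0 t1] := t01; have [lJ Jzz Jle] := HJ (z - q).
have := Jzz; rewrite [X in J _ X]resolvent_sub (linear_add _ (t *: _) _ lJ).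
rewrite !(linear_scale _ _ _ lJ).
have t1' : 0 <= 1 - t by rewrite subr_ge0.
have : J (z - q) (T z - q) <= `|z - q| ^+ 2.
  apply: le_trans (Jle _) _; rewrite expr2 ler_wpM2l//.
  exact: resolvent_image_dist.
move=> /(ler_wpM2l t1') H1 H2; rewrite -(ler_pM2l t0).
lra.
Qed.

End resolvent.

Section asymptotic_center.
Context {R : realType} {E : normedModType R}.
Variables (C : set E) (z : nat -> E).

(** The upper limit of the distances from [z n] to [x] is at most [r]; the slack [e] avoids forming
    that limit. *)
Definition asymptotic_ball (r : R) : set E :=
  [set x | C x /\ forall e, 0 < e -> \forall n \near \oo, `|z n - x| <= r + e].

Lemma asymptotic_ball_closed r : closed C -> closed (asymptotic_ball r).
Proof.
move=> clC x clx; split.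
  by apply: clC => B /clx[w [[Cw _] Bw]]; exists w.
move=> e e0; have e2 : 0 < e / 2 by rewrite divr_gt0.
have [w [[_ wz]]] := clx _ (nbhsx_ballx x _ e2).
rewrite -ball_normE/= => xw; have := wz _ e2; apply: filterS => n zw.
have := ler_normD (z n - w) (w - x); rewrite addrA subrK [`|w - x|]distrC.
by lra.
Qed.

Lemma asymptotic_ball_convex r : @convex_set R E C ->
  @convex_set R E (asymptotic_ball r).
Proof.
move=> /convex_set_lmodP cC; apply/convex_set_lmodP => t x y t01 [Cx zx] [Cy zy].
split; first exact: cC.
move=> e e0; have /andP[t0 t1] := t01.
apply: filterS2 (zx _ e0) (zy _ e0) => n zxn zyn.
have -> : z n - (t *: x + (1 - t) *: y) = t *: (z n - x) + (1 - t) *: (z n - y).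
  rewrite !scalerBr addrACA -scalerDl [t + _]addrC subrK scale1r opprD.
  by [].
have t1' : 0 <= 1 - t by rewrite subr_ge0.
apply: le_trans (ler_normD _ _) _; rewrite !normrZ !ger0_norm//.
have := ler_wpM2l t0 zxn; have := ler_wpM2l t1' zyn; lra.
Qed.

Lemma asymptotic_ball_bounded r : bounded_fun z -> bounded_set (asymptotic_ball r).
Proof.
move=> [M [_ zM]]; exists (`|M| + 1 + (r + 1)); split; first exact: num_real.
move=> N MN x [_ /(_ 1 ltr01)/filter_ex[n zx]].
have := zM (`|M| + 1); rewrite (le_lt_trans (ler_norm M)) ?ltrDl//.
move=> /(_ isT n I) /= zn.
have := ler_normD (z n) (x - z n); rewrite addrC subrK [`|x - _|]distrC.
by lra.
Qed.

Lemma asymptotic_ball_mono r s : r <= s ->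
  asymptotic_ball r `<=` asymptotic_ball s.
Proof.
move=> rs x [Cx zx]; split=> // e /zx; apply: filterS => n; lra.
Qed.

(** [r] is the infimum of the eventual radii. The balls of radius [r + n.+1%:R^-1] are nonempty and
    decreasing; reflexivity gives a common point, which lies in the ball of radius [r]. *)
Lemma asymptotic_center_exists : reflexive_space E -> C !=set0 -> closed C ->
  @convex_set R E C -> bounded_fun z ->
  exists r, [/\ 0 <= r, asymptotic_ball r !=set0 &
    forall x s, C x -> (\forall n \near \oo, `|z n - x| <= s) -> r <= s].
Proof.
move=> rE [c Cc] clC cC bz.
pose D := [set s | exists2 x, C x & \forall n \near \oo, `|z n - x| <= s].
have Dge s : D s -> 0 <= s by move=> [x _ /filter_ex[n]]; exact: le_trans.
have D0 : D !=set0.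
  have [M [_ zM]] := bz; exists (`|M| + 1 + `|c|), c => //; apply: nearW => n.
  have := zM (`|M| + 1); rewrite (le_lt_trans (ler_norm M)) ?ltrDl//.
  move=> /(_ isT n I) /= zn.
  by apply: le_trans (ler_normB _ _) _; rewrite lerD2r.
have lD : has_lbound D by exists 0 => s; exact: Dge.
pose r := inf D; exists r; split.
- by apply: lb_le_inf => // s; exact: Dge.
- pose K n := asymptotic_ball (r + n.+1%:R^-1).
  have [||||m n mn|x Kx] := reflexive_bigcap_neq0 K rE.
  + move=> n; have [|s [x Cx zx] sr] := @inf_adherent R D n.+1%:R^-1 _ (conj D0 lD).
      by rewrite invr_gt0.
    exists x; split=> // e e0; move: zx; apply: filterS => k zk.
    apply: le_trans zk _; apply: ltW; apply: lt_trans sr _.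
    by rewrite ltrDl.
  + exact: asymptotic_ball_bounded.
  + by move=> n; exact: asymptotic_ball_closed.
  + by move=> n; exact: asymptotic_ball_convex.
  + by apply: asymptotic_ball_mono; rewrite lerD2l lef_pV2 ?posrE// ler_nat.
  exists x; split; first by have [] := Kx 0%N I.
  move=> e e0; have e2 : 0 < e / 2 by rewrite divr_gt0.
  have re : r < r + e / 2 by rewrite ltrDl.
  have [k ke] := ltr_add_invr re.
  have [_ /(_ _ e2)] := Kx k I; apply: filterS => n zk.
  apply: le_trans zk _; rewrite [in leRHS](splitr e) addrA lerD2r; exact: ltW.
- by move=> x s Cx zx; apply: ge_inf => //; exists x.
Qed.

End asymptotic_center.

(** * Convergence of the resolvent path *)

Section resolvent_path.
Context {R : realType} {E : normedModType R}.
Variables (J : E -> E -> R^o) (HJ : duality_selection J).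
Hypothesis smooth : uniformly_Gateaux_differentiable_norm E.
Variable C : set E.
Hypotheses (clC : closed C) (cC : @convex_set R E C).

(* The upper expansion at [z n - p] in the direction [u - p] shows that moving
   the centre from [p] slightly towards [u] would decrease the radius. *)
Lemma asymptotic_radius_le0 (z : nat -> E) (u p : E) (r : R) :
  C u -> asymptotic_ball C z r p ->
  (forall x s, C x -> (\forall n \near \oo, `|z n - x| <= s) -> r <= s) ->
  (forall n, `|z n - p| ^+ 2 <= J (z n - p) (u - p)) -> r <= 0.
Proof.
move=> Cu [Cp zp] rmin Jz; rewrite leNgt; apply/negP => r0.
have e0 : 0 < r ^+ 2 / 2 by rewrite divr_gt0// exprn_gt0.
have [k k0 Hk] := duality_upper_expansion J HJ smooth (u - p) (r + 1) _ e0.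
pose l := Num.min k (1 / 2).
have l0 : 0 < l by rewrite lt_min k0 divr_gt0.
have [lk l1] : l <= k /\ l <= 1 / 2 by split; rewrite ge_min lexx// orbT.
suff : r <= r * (1 - l / 4) by have := mulr_gt0 r0 l0; lra.
have Cx : C (l *: u + (1 - l) *: p).
  by move/convex_set_lmodP : cC; apply => //; lra.
apply: (rmin _ _ Cx); have rl0 : 0 < r * l / 4 by have := mulr_gt0 r0 l0; lra.
have zpr := zp _ rl0; have zp1 := zp _ ltr01; near=> n.
have -> : z n - (l *: u + (1 - l) *: p) = z n - p - l *: (u - p).
  by rewrite scalerBl scale1r scalerBr addrCA opprD addrA.
have lk' : 0 < l <= k by rewrite l0.
have zn1 : `|z n - p| <= r + 1 by near: n.
have znr : `|z n - p| <= r + r * l / 4 by near: n.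
have := Hk l (z n - p) lk' zn1; have := ler_wpM2l (ltW l0) (Jz n).
set b := `|z n - p - _|; set a := `|z n - p| in znr *.
have a0 : 0 <= a by exact: normr_ge0.
have b0 : 0 <= b by exact: normr_ge0.
(* With [Jz] the expansion reads [b ^+ 2 <= (1 - 2 * l) * a ^+ 2 + l * r ^+ 2 / 2]; the choice
   [l <= 1 / 2] lets the bound on [a] be inserted. *)
have : a ^+ 2 <= (r + r * l / 4) ^+ 2 by rewrite ler_pXn2r ?nnegrE//; lra.
have l2 : 0 <= 1 - 2 * l by lra.
move=> /(ler_wpM2l l2) H1 H2 H3.
have r4 : 0 <= r * (1 - l / 4) by rewrite mulr_ge0; lra.
rewrite -(@ler_pXn2r _ 2)// ?nnegrE//.
have P1 : 0 <= r ^+ 2 * l by rewrite mulr_ge0 ?sqr_ge0// ltW.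
have P2 : 0 <= r ^+ 2 * l ^+ 2 by rewrite mulr_ge0 ?sqr_ge0.
have P3 : 0 <= r ^+ 2 * l ^+ 3 by rewrite mulr_ge0 ?sqr_ge0// exprn_ge0// ltW.
lra.
Unshelve. all: end_near. Qed.

Hypotheses (rE : reflexive_space E) (fppE : fixed_point_property E).
Variables (T Q : E -> E) (u : E).
Hypotheses (T_self : set_fun C C T) (nT : nonexpansive C T).
Hypothesis (snrQ : sunny_nonexpansive_retraction C (fixed_points C T) Q).
Hypothesis (Cu : C u).

Let FC : fixed_points C T `<=` C. Proof. by move=> x []. Qed.

Let FQu : fixed_points C T (Q u).
Proof. by have [[<- _] _ _] := snrQ; exists u. Qed.

Lemma resolvent_path_cvg (z : nat -> E) (t : nat -> R) :
  (forall n, 0 < t n <= 1) -> t n @[n --> \oo] --> (0 : R) ->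
  (forall n, C (z n)) ->
  (forall n, z n = t n *: u + (1 - t n) *: T (z n)) ->
  z n @[n --> \oo] --> Q u.
Proof.
move=> t01 t0 Cz zE; pose B := `|u - Q u|.
have zB n : `|z n - Q u| <= B :=
  resolvent_dist C T u _ _ _ nT (t01 n) (Cz n) (zE n) FQu.
have bz : bounded_fun z.
  exists (B + `|Q u|); split; first exact: num_real.
  move=> M BM n _ /=; apply: le_trans (ltW BM).
  by rewrite -{1}(subrK (Q u) (z n)); apply: le_trans (ler_normD _ _) _; rewrite lerD2r.
have zTz e : 0 < e -> \forall n \near \oo, `|z n - T (z n)| <= e.
  move=> e0; have B1 : 0 < 2 * B + 1 by rewrite ltr_wpDl// mulr_ge0// normr_ge0.
  have e1 : 0 < e / (2 * B + 1) by rewrite divr_gt0.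
  have /cvgrPdist_le/(_ _ e1) := t0; apply: filterS => n.
  have /andP[tn0 tn1] := t01 n.
  rewrite sub0r normrN gtr0_norm// ler_pdivlMr// => te; apply: le_trans te.
  have -> : z n - T (z n) = t n *: (u - T (z n)).
    by rewrite [X in X - _]zE scalerBl scale1r scalerBr addrAC subrKA.
  rewrite normrZ gtr0_norm// ler_pM2l//.
  have := resolvent_image_dist C T _ _ nT (Cz n) FQu.
  have := ler_distD (Q u) u (T (z n)); rewrite (distrC (Q u)) -/B.
  by have := zB n; lra.
have [r [r0 Ar0 rmin]] :=
  asymptotic_center_exists C z rE (ex_intro _ u Cu) clC cC bz.
have [|x [Cx zx]|x y Ax Ay|p [Ap Tp]] := fppE _ Ar0 _
  (asymptotic_ball_closed C z r clC)
  (asymptotic_ball_convex C z r cC) T.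
- exact: asymptotic_ball_bounded.
(* Invariance under [T]: replacing [z n] by [T (z n)] eventually costs at most [e / 2]. *)
- split; first exact: T_self.
  move=> e e0; have e2 : 0 < e / 2 by rewrite divr_gt0.
  apply: filterS2 (zx _ e2) (zTz _ e2) => n H1 H2.
  have := ler_distD (T (z n)) (z n) (T x).
  by have := nT _ _ (Cz n) Cx; lra.
- by apply: nT; [case: Ax|case: Ay].
have Fp : fixed_points C T p by split=> //; case: Ap.
have rle0 : r <= 0.
  apply: asymptotic_radius_le0 Cu Ap rmin _ => n.
  exact: resolvent_variational nT (t01 n) (Cz n) (zE n) Fp J HJ.
have zp : z n @[n --> \oo] --> p.
  apply/cvgrPdist_le => e e0; have [_ /(_ _ e0)] := Ap; apply: filterS => n.
  by rewrite distrC; lra.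
suff -> : Q u = p by [].
have pQ : J (p - Q u) (u - Q u) <= 0.
  exact: (sunny_retraction_variational J HJ smooth _ _ _ _ _ cC FC snrQ Cu Fp).
apply/eqP; rewrite eq_sym -subr_eq0 -normr_eq0 -sqrf_eq0 eq_le sqr_ge0 andbT.
have zQ : `|z n - Q u| ^+ 2 @[n --> \oo] --> `|p - Q u| ^+ 2.
  have zQ := cvg_norm (cvgB zp (cvg_cst (Q u))).
  rewrite expr2; under eq_fun do rewrite expr2.
  by apply: cvgM; exact: zQ.
(* The squared norm of [z n - Q u] is at most [J (z n - Q u) (u - Q u)], which for large [n] exceeds
   [J (p - Q u) (u - Q u) <= 0] by at most [e]. *)
apply/ler_addgt0Pr => e e0; rewrite add0r.
apply: (cvgr_to_le zQ).
have pB : `|p - Q u| <= B.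
  by apply: (cvgr_to_le (cvg_norm (cvgB zp (cvg_cst (Q u))))); exact: nearW.
have [d d0 Hd] := duality_uniformly_continuous J HJ smooth (u - Q u) B _ e0.
have /cvgrPdist_le/(_ _ d0) := zp; apply: filterS => n znp.
have := resolvent_variational C T u _ _ _ nT (t01 n) (Cz n) (zE n) FQu J HJ.
move=> /le_trans; apply.
have := Hd _ _ (zB n) pB; rewrite opprB addrA subrK distrC => /(_ znp).
lra.
Qed.

End resolvent_path.

(** A resolvent [z] of one small parameter [t] stands in for [Q u]: replacing [J (w - Q u)] by
    [J (w - z)] and splitting [u - Q u] at [z] leaves three terms, each at most [e / 4]. *)
Lemma approximate_fixed_point_variational (R : realType)
    (E : completeNormedModType R) (J : E -> E -> R^o) (C : set E)
    (T Q : E -> E) (u : E) (M e : R) :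
  duality_selection J -> uniformly_Gateaux_differentiable_norm E ->
  closed C -> @convex_set R E C -> reflexive_space E -> fixed_point_property E ->
  set_fun C C T -> nonexpansive C T ->
  sunny_nonexpansive_retraction C (fixed_points C T) Q -> C u -> 0 < e ->
  exists2 d, 0 < d & forall w, C w -> `|w - Q u| <= M -> `|w - T w| <= d ->
    J (w - Q u) (u - Q u) <= e.
Proof.
move=> HJ smooth clC cC rE fppE T_self nT snrQ Cu e0.
pose s n : R := n.+1%:R^-1.
have s01 n : 0 < s n <= 1 by rewrite invr_gt0 ltr0n/= invf_le1// ler1n.
have s0 : s n @[n --> \oo] --> (0 : R) by exact: cvg_harmonic.
have /choice[z zP] : forall n, exists x, C x /\ x = s n *: u + (1 - s n) *: T x.
  move=> n; have [x Cx xE] :=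
    resolvent_exists E C T u (s n) clC cC T_self nT Cu (s01 n).
  by exists x.
have zp : z n @[n --> \oo] --> Q u.
  apply: (resolvent_path_cvg J HJ smooth C clC cC rE fppE T Q u T_self nT snrQ Cu
    z s) => // n; by case: (zP n).
pose B := `|M| + 1; have B0 : 0 < B by rewrite ltr_wpDl.
have e4 : 0 < e / 4 by rewrite divr_gt0.
have [d1 d10 Hd1] := duality_uniformly_continuous J HJ smooth (u - Q u) B _ e4.
(* In order: for the bound [B] on [w - z], for the continuity of [J], for [J (w - z) (z - Q u)], and
   for the term [t ^+ 2 * a ^+ 2]. *)
have [n [zn1 znd znB sn]] : exists n, [/\ `|z n - Q u| <= 1, `|z n - Q u| <= d1,
    `|z n - Q u| <= e / 4 / B & s n <= e / 4 / B ^+ 2].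
  have H c : 0 < c -> \forall n \near \oo, `|z n - Q u| <= c.
    by move=> c0; have /cvgrPdist_le/(_ _ c0) := zp; apply: filterS => n; rewrite distrC.
  have [n []] := filter_ex (filterI (filterI (H _ ltr01) (H _ d10))
    (filterI (H _ (divr_gt0 e4 B0))
      (proj1 (cvgrPdist_le _ _) s0 _ (divr_gt0 e4 (exprn_gt0 2 B0))))).
  move=> [? ?] [? H']; exists n; split => //; move: H'; rewrite sub0r normrN.
  exact: le_trans (ler_norm _).
have [Cz zE] := zP n; have /andP[t0 t1] := s01 n.
move: (z n) (s n) Cz zE t0 t1 zn1 znd znB sn => {z zP zp s01 s0 s}.
move=> {}z t Cz zE t0 t1 zn1 znd znB sn.
(* [t] is fixed by now, so [d] may depend on it; this choice yields
   [(d + a) ^+ 2 - a ^+ 2 <= t * e / 4]. *)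
pose d := Num.min 1 (t * e / 4 / (2 * B + 1)).
have B21 : 0 < 2 * B + 1 by lra.
have d0 : 0 < d by rewrite lt_min ltr01/= !divr_gt0// mulr_gt0.
exists d => // w Cw wM wTw.
have [dle1 dle] : d <= 1 /\ d * (2 * B + 1) <= t * e / 4.
  by split; [|rewrite -ler_pdivlMr//]; rewrite ge_min lexx// orbT.
have wp : `|w - Q u| <= B by apply: le_trans wM _; have := ler_norm M; rewrite /B; lra.
have wz : `|w - z| <= B.
  have := ler_distD (Q u) w z; rewrite (distrC (Q u)).
  by have := ler_norm M; rewrite /B; lra.
have := Hd1 _ _ wp wz; rewrite opprB addrC subrKA => /(_ znd).
have [lJ Jaa Jle] := HJ (w - z).
have -> : J (w - z) (u - Q u) = J (w - z) (u - z) + J (w - z) (z - Q u).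
  by rewrite -(linear_add _ _ _ lJ) addrA subrK.
have J2 : J (w - z) (z - Q u) <= e / 4.
  apply: le_trans (Jle _) _; move: znB; rewrite ler_pdivlMr// mulrC; apply: le_trans.
  by rewrite ler_wpM2r.
suff : J (w - z) (u - z) <= e / 4 by lra.
(* The shift is chosen so that the resolvent equation turns the shifted vector into
   [(1 - t) *: (w - T z)]. Then [H5] and [H4] together bound [2 * t * J (w - z) (u - z)]. *)
have := duality_subgradient J HJ (w - z) (- (t *: (w - u))).
have -> : w - z - t *: (w - u) = (1 - t) *: (w - T z).
  have zu : (1 - t) *: T z = z - t *: u by rewrite [in RHS]zE addrAC subrr add0r.
  rewrite !scalerBr zu scalerBl scale1r !opprB addrACA [RHS]addrACA.
  by congr (_ + _); exact: addrC.
rewrite (linear_opp _ _ lJ) (linear_scale _ _ _ lJ).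
have -> : J (w - z) (w - u) = `|w - z| ^+ 2 - J (w - z) (u - z).
  by rewrite -Jaa -(linear_sub _ _ _ lJ) opprB addrA subrK.
have t1' : 0 <= 1 - t by lra.
rewrite normrZ ger0_norm// exprMn.
have wTz : `|w - T z| <= d + `|w - z|.
  by have := ler_distD (T w) w (T z); have := nT _ _ Cw Cz; lra.
have : `|w - T z| ^+ 2 <= (d + `|w - z|) ^+ 2.
  by rewrite ler_pXn2r ?nnegrE// addr_ge0// ltW.
move=> /(ler_wpM2l (sqr_ge0 (1 - t))).
set a := `|w - z| in wz wTz *; have a0 : 0 <= a by exact: normr_ge0.
set j := J _ _; set g := `|_| ^+ 2 => H1 H2.
have H3 : (d + a) ^+ 2 - a ^+ 2 <= t * e / 4.
  apply: le_trans dle; have : d * a <= d * B by rewrite ler_pM2l.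
  have : d * d <= d * 1 by rewrite ler_pM2l.
  lra.
have H4 : t ^+ 2 * a ^+ 2 <= t * (e / 4).
  rewrite expr2 -mulrA ler_pM2l//; move: sn; rewrite ler_pdivlMr ?exprn_gt0//.
  apply: le_trans; rewrite ler_pM2l// ler_pXn2r ?nnegrE//; exact: ltW.
have H5 : (1 - t) ^+ 2 * ((d + a) ^+ 2 - a ^+ 2) <= t * e / 4.
  have te0 : 0 <= t * e / 4 by rewrite divr_ge0// mulr_ge0// ltW.
  apply: le_trans (_ : 1 * (t * e / 4) <= _); last by rewrite mul1r.
  apply: ler_pM => //; first exact: sqr_ge0.
    have := mulr_ge0 (ltW d0) a0; have := sqr_ge0 d; lra.
  by rewrite -[leRHS](expr1n _ 2) ler_pXn2r ?nnegrE//; lra.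
rewrite -(ler_pM2l t0); lra.
Qed.

(** * Viscosity iteration *)

(** While [s n] exceeds [2 * e], each step lowers it by at least [c * a n * e], which divergence of
    the series forbids forever. Once at most [2 * e], it stays so, the recursion being a convex
    combination with [e]. *)
Lemma halpern_recursion_eventually_le (R : realType) (s a : nat -> R) (c e : R) :
  0 < c -> 0 < e -> (forall n, 0 <= a n) -> (forall n, c * a n <= 1) ->
  (forall n, 0 <= s n) -> series a n @[n --> \oo] --> +oo ->
  (\forall n \near \oo, s n.+1 <= (1 - c * a n) * s n + c * a n * e) ->
  \forall n \near \oo, s n <= 2 * e.
Proof.
move=> c0 e0 a0 a1 s0 aoo [N _ sN].
have ca n : 0 <= c * a n by rewrite mulr_ge0// ltW.
have [m Nm sm] : exists2 m, (N <= m)%N & s m <= 2 * e.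
  apply: contrapT => H; have {}H n : (N <= n)%N -> 2 * e < s n.
    by move=> Nn; rewrite ltNge; apply/negP => sn; apply: H; exists n.
  pose K := s N + c * e * series a N.
  have inv k : s (N + k)%N + c * e * series a (N + k)%N <= K.
    elim: k => [|k IH]; first by rewrite addn0.
    apply: le_trans IH; rewrite addnS seriesEnat/= big_nat_recr//=.
    have := sN (N + k)%N (leq_addr _ _); have := H _ (leq_addr k N).
    move=> /ltW/(ler_wpM2l (ca (N + k)%N)); have := mulr_ge0 (ca (N + k)%N) (ltW e0).
    by lra.
  have ce0 : 0 < c * e by rewrite mulr_gt0.
  have /cvgryPgt/(_ (K / (c * e))) := aoo.
  move=> /(filterI (nbhs_infty_ge N))/filter_ex[n [/= Nn]].
  have := inv (n - N)%N; rewrite subnKC// => Kn.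
  rewrite ltr_pdivrMr// => Kl; have := s0 n; lra.
exists m => // n /= mn; rewrite -(subnKC mn); elim: (n - m)%N => [|k IH].
  by rewrite addn0.
have /sN : (N <= m + k)%N by exact: leq_trans (leq_addr _ _).
rewrite addnS => H; apply: le_trans H _.
have h1 : 0 <= 1 - c * a (m + k)%N by rewrite subr_ge0.
have := ler_wpM2l h1 IH; have := mulr_ge0 (ca (m + k)%N) (ltW e0); lra.
Qed.

Lemma increasing_subsequence (P : nat -> nat -> Prop) :
  (forall k N, exists2 n, (N <= n)%N & P k n) ->
  exists phi : nat -> nat, (forall k, P k (phi k)) /\
    {homo phi : i j / (i < j)%N >-> (i < j)%N}.
Proof.
move=> HP; have /choice[h hP] : forall kN : nat * nat,
    exists n, (kN.2 <= n)%N /\ P kN.1 n.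
  by move=> [k N]; have [n] := HP k N; exists n.
pose phi := fix phi k := if k is k'.+1 then h (k, (phi k').+1) else h (0%N, 0%N).
exists phi; split=> [[|k]|]; [exact: (hP (0%N, 0%N)).2|exact: (hP (k.+1, _)).2|].
by apply: homo_ltn => [|i]; [exact: ltn_trans|exact: (hP (i.+1, (phi i).+1)).1].
Qed.

(** * Strong nonexpansiveness and the NST condition along the iterates *)

Section strongly_nonexpansive.
Context {R : realType} {E : normedModType R}.
Variables (C : set E) (S : nat -> E -> E) (T : E -> E) (p : E) (y : nat -> E) (B : R).
Hypotheses (S_strong : strongly_nonexpansive_seq C S) (S_NST : NST_condition_I C S T).
Hypotheses (Fp : common_fixed_points C S p) (Cy : forall n, C (y n)).
Hypothesis yB : forall n, `|y n - p| <= B.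

(* The hypotheses only concern full sequences: a bad subsequence of [y] is
   completed by the common fixed point [p]. *)
Lemma strongly_nonexpansive_near e : 0 < e ->
  exists2 d, 0 < d & \forall n \near \oo,
    `|y n - p| - `|S n (y n) - p| <= d ->
    `|y n - S n (y n)| <= e /\ `|y n - T (y n)| <= e.
Proof.
move=> e0; apply: contrapT => H.
pose good n := `|y n - S n (y n)| <= e /\ `|y n - T (y n)| <= e.
have Cp : C p by have [] := Fp 0%N I.
have Sp n : S n p = p by have [] := Fp n I.
have [phi [phiP phi_lt]] : exists phi : nat -> nat,
    (forall k, `|y (phi k) - p| - `|S (phi k) (y (phi k)) - p| <= k.+1%:R^-1 /\
      ~ good (phi k)) /\ {homo phi : i j / (i < j)%N >-> (i < j)%N}.
  apply: (increasing_subsequence (fun k n =>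
    `|y n - p| - `|S n (y n) - p| <= k.+1%:R^-1 /\ ~ good n)) => k N.
  apply: contrapT => H1; apply: H; exists k.+1%:R^-1; first by rewrite invr_gt0.
  exists N => // n /= Nn yn; apply: contrapT => bad; apply: H1.
  by exists n.
have phi_ge k : (k <= phi k)%N.
  elim: k => // k IH; apply: leq_ltn_trans IH _; exact: phi_lt.
pose x n := if `[< exists k, phi k = n >] then y n else p.
have Cx n : C (x n) by rewrite /x; case: ifP.
have xphi k : x (phi k) = y (phi k).
  by rewrite /x; case: asboolP => // -[]; exists k.
have B0 : 0 <= B by exact: le_trans (yB 0%N).
have xB n : `|x n - p| <= B by rewrite /x; case: ifP => _ //; rewrite subrr normr0.
have [nS strong] := S_strong; have [_ _ NST] := S_NST.
have xS : (x n - S n (x n)) @[n --> \oo] --> (0 : E).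
  (* Comparison with the constant sequence [p], fixed by every [S n], turns the conclusion of strong
     nonexpansiveness into one on residuals. *)
  have -> : (fun n => x n - S n (x n)) = (fun n => x n - p - (S n (x n) - S n p)).
    by apply/funext => n; rewrite Sp opprB subrKA.
  apply: (strong x (fun=> p)) => //.
    exists B; split; first exact: num_real.
    by move=> M BM n _ /=; exact: le_trans (xB n) (ltW BM).
  apply/cvgrPdist_le => e' e'0.
  have [k ke] := ltr_add_invr e'0; rewrite add0r in ke.
  (* If [n >= phi k] is some [phi j], then [j >= k] and the gap is at most [k.+1%:R^-1]; at any
     other [n] it is 0. *)
  exists (phi k) => // n /= kn; rewrite sub0r normrN ger0_norm ?subr_ge0 ?nS//.
  rewrite /x; case: asboolP => [[j jn]|_]; last first.
    by rewrite !subrr ltW.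
  rewrite Sp -jn; apply: le_trans (phiP j).1 _; apply: le_trans (ltW ke).
  rewrite lef_pV2 ?posrE// ler_nat ltnS leqNgt; apply/negP => /phi_lt.
  by rewrite jn ltnNge kn.
have bx : bounded_fun x.
  exists (B + `|p|); split; first exact: num_real.
  move=> M BM n _ /=; apply: le_trans (ltW BM).
  by rewrite -{1}(subrK p (x n)); apply: le_trans (ler_normD _ _) _; rewrite lerD2r.
have xT := NST x Cx bx xS.
have /cvgrPdist_le/(_ _ e0) H1 := xS; have /cvgrPdist_le/(_ _ e0) H2 := xT.
have [N _ HN] := filterI H1 H2.
have [H3 H4] := HN (phi N) (phi_ge N).
by apply: (phiP N).2; move: H3 H4; rewrite /= !xphi !sub0r !normrN.
Qed.

End strongly_nonexpansive.

(** * Estimates for a single step of the iteration *)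

Section viscosity.
Context {R : realType} {E : normedModType R}.
Variables (J : E -> E -> R^o) (HJ : duality_selection J).
Variables (C F : set E) (S f : E -> E) (a theta : R) (x x' p u : E).
Hypotheses (a01 : 0 < a <= 1) (theta01 : 0 <= theta < 1).
Hypotheses (nS : nonexpansive C S) (f_contr : contraction_wrt C F theta f).
Hypotheses (Cx : C x) (Cp : C p) (Fp : F p) (Sp : S p = p).
Hypothesis (x'E : x' = a *: f x + (1 - a) *: S x).

Let x'_sub : x' - p = a *: (f x - p) + (1 - a) *: (S x - p).
Proof.
by rewrite x'E !scalerBr addrACA -opprD -scalerDl [a + _]addrC subrK scale1r.
Qed.

Lemma viscosity_step_image : `|S x - p| <= `|x - p|.
Proof. by rewrite -{1}Sp; exact: nS. Qed.

Lemma viscosity_step_contr : `|f x - p| <= theta * `|x - p| + `|f p - p|.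
Proof.
by have := ler_distD (f p) (f x) p; have := f_contr x p Cx Fp; lra.
Qed.

Lemma viscosity_step_dist :
  `|x' - p| <= a * `|f x - p| + (1 - a) * `|S x - p|.
Proof.
have /andP[a0 a1] := a01; rewrite x'_sub; apply: le_trans (ler_normD _ _) _.
by rewrite !normrZ gtr0_norm// ger0_norm// subr_ge0.
Qed.

(** Applying [J (x' - p)] to the recursion gives [r' ^+ 2 <= (1 - (1 - theta) * a) * (r * r') + a *
    e]; then [2 * r * r' <= r ^+ 2 + r' ^+ 2] separates the two norms. *)
Lemma viscosity_step_sqr e :
  `|x' - p| * `|f p - u| + J (x' - p) (u - p) <= e ->
  `|x' - p| ^+ 2 <= (1 - (1 - theta) * a) * `|x - p| ^+ 2 + 2 * a * e.
Proof.
move=> He; have /andP[a0 a1] := a01; have /andP[th0 th1] := theta01.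
have [lJ Jxx Jle] := HJ (x' - p).
have := Jxx; rewrite [X in J _ X]x'_sub (linear_add _ (a *: _) _ lJ).
rewrite !(linear_scale _ _ _ lJ).
have -> : f x - p = (f x - f p) + ((f p - u) + (u - p)).
  by rewrite !addrA !subrK.
rewrite (linear_add _ (f x - f p) _ lJ) (linear_add _ (f p - u) (u - p) lJ).
have a1' : 0 <= 1 - a by lra.
set r' := `|x' - p| in He Jle *; have r'0 : 0 <= r' by exact: normr_ge0.
set r := `|x - p|; have r0 : 0 <= r by exact: normr_ge0.
have J1 : J (x' - p) (f x - f p) <= r' * (theta * r).
  by apply: le_trans (Jle _) _; rewrite ler_wpM2l//; exact: f_contr.
have J2 := Jle (f p - u).
have J3 : J (x' - p) (S x - p) <= r' * r.
  by apply: le_trans (Jle _) _; rewrite ler_wpM2l// viscosity_step_image.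
have J4 : a * (J (x' - p) (f x - f p) + (J (x' - p) (f p - u) + J (x' - p) (u - p)))
    <= a * (r' * (theta * r) + e) by rewrite ler_pM2l//; lra.
have := ler_wpM2l a1' J3; move: J4; set X := a * _; set Y := (1 - a) * _ => XH YH XY.
have {XH YH XY} : r' ^+ 2 <= (1 - (1 - theta) * a) * (r * r') + a * e by lra.
have k0 : 0 <= (1 - theta) * a by rewrite mulr_ge0//; lra.
have k1 : 0 <= 1 - (1 - theta) * a.
  by rewrite subr_ge0 mulr_ile1//; lra.
have := mulr_ge0 k1 (sqr_ge0 (r - r')); have := mulr_ge0 k0 (sqr_ge0 r').
lra.
Qed.

End viscosity.

Theorem theorem4p6 (R : realType) (E : completeNormedModType R)
  (E_reflexive : reflexive_space E)
  (E_smooth : uniformly_Gateaux_differentiable_norm E)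
  (E_fpp : fixed_point_property E)
  (C : set E) (C_nonempty : C !=set0) (C_closed : closed C)
  (C_convex : @convex_set R E C)
  (S : nat -> E -> E) (S_self : forall n, set_fun C C (S n))
  (T : E -> E) (T_self : set_fun C C T) (T_nonexp : nonexpansive C T)
  (alpha : nat -> R) (alpha_01 : forall n, 0 < alpha n <= 1)
  (alpha_cvg : alpha n @[n --> \oo] --> (0 : R))
  (alpha_sum : series alpha n @[n --> \oo] --> +oo)
  (S_strong : strongly_nonexpansive_seq C S)
  (S_NST : NST_condition_I C S T)
  (Q : E -> E) (Q_snr : sunny_nonexpansive_retraction C (fixed_points C T) Q)
  (f : nat -> E -> E) (f_self : forall n, set_fun C C (f n))
  (y : nat -> E) (y_init : C (y 0%N))
  (y_rec : forall n,
     y n.+1 = alpha n *: f n (y n) + (1 - alpha n) *: S n (y n))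
  (theta : R) (theta_01 : 0 <= theta < 1)
  (f_contr : forall n, contraction_wrt C (common_fixed_points C S) theta (f n))
  (u : E) (u_in : C u)
  (f_cvg : f n (Q u) @[n --> \oo] --> u) :
  y n @[n --> \oo] --> Q u.
Proof.
have [J HJ] := @duality_selection_exists R E.
have /andP[theta0 theta1] := theta_01.
have FQu : fixed_points C T (Q u) by have [[<- _] _ _] := Q_snr; exists u.
set p := Q u in f_cvg FQu *.
have Cp : C p by case: FQu.
have Fp : common_fixed_points C S p by case: S_NST => _ + _; apply.
have Sp n : S n p = p by have [] := Fp n I.
have nS n : nonexpansive C (S n) by case: S_strong.
have Cy n : C (y n).
  elim: n => // n IH; rewrite y_rec; move/convex_set_lmodP : C_convex; apply.
  - by have /andP[/ltW -> ->] := alpha_01 n.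
  - exact: f_self.
  - exact: S_self.
pose L := sup (range (fun n => `|f n p - p|)).
have fL n : `|f n p - p| <= L.
  apply: ub_le_sup; last by exists n.
  have : bounded_fun (fun n => f n p - p).
    apply: cvg_seq_bounded; apply: is_cvgB; last exact: is_cvg_cst.
    by apply/cvg_ex; exists u.
  move=> [M [_ HM]]; exists (`|M| + 1) => _ [k _ <-]; apply: (HM _ _ k) => //.
  by rewrite (le_lt_trans (ler_norm M))// ltrDl.
pose c := 1 - theta; have c0 : 0 < c by rewrite /c; lra.
(* The bound [B] is invariant, because [L <= (1 - theta) * B] gives [theta * B + L <= B]. *)
pose B := Num.max `|y 0%N - p| (L / c).
have LB : L <= c * B by rewrite mulrC -ler_pdivrMr// le_max lexx orbT.
have stepf n : `|y n - p| <= B -> `|f n (y n) - p| <= B.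
  move=> yn; have := viscosity_step_contr _ _ _ _ _ _ (f_contr n) (Cy n) Fp.
  by have := ler_wpM2l theta0 yn; have := fL n; rewrite /c in LB; lra.
have yB n : `|y n - p| <= B.
  elim: n => [|n IH]; first by rewrite le_max lexx.
  have /andP[a0 a1] := alpha_01 n.
  apply: le_trans (viscosity_step_dist _ _ _ _ _ p (alpha_01 n) (y_rec n)) _.
  have a1' : 0 <= 1 - alpha n by lra.
  have := ler_wpM2l (ltW a0) (stepf n IH).
  have SB := viscosity_step_image _ _ _ _ (nS n) (Cy n) Cp (Sp n).
  have := ler_wpM2l a1' (le_trans SB IH).
  by lra.
have B0 : 0 <= B by exact: le_trans (yB 0%N).
have alpha_le e : 0 < e -> \forall n \near \oo, alpha n <= e.
  move=> e0; have /cvgrPdist_le/(_ _ e0) := alpha_cvg; apply: filterS => n.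
  by rewrite sub0r normrN; exact: le_trans (ler_norm _).
have alphaB_le e : 0 < e -> \forall n \near \oo, alpha n * (B + 1) <= e.
  move=> e0; have := alpha_le (e / (B + 1)); rewrite divr_gt0 ?ltr_wpDl// => /(_ isT).
  by apply: filterS => n; rewrite ler_pdivlMr// ltr_wpDl.
have step e : 0 < e -> \forall n \near \oo,
    `|y n.+1 - p| ^+ 2 <= (1 - c * alpha n) * `|y n - p| ^+ 2 + 2 * alpha n * e.
  move=> e0; have e2 : 0 < e / 2 by rewrite divr_gt0.
  have [d d0 Hd] := approximate_fixed_point_variational R E J C T Q u B _ HJ
    E_smooth C_closed C_convex E_reflexive E_fpp T_self T_nonexp Q_snr u_in e2.
  (* The residual at [y n.+1] is at most twice the displacement, [2 * (d / 4 + d / 6)], plus the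
     residual [d / 6] at [y n], in total [d]. *)
  have d6 : 0 < d / 6 by rewrite divr_gt0.
  have [k k0 Hk] :=
    strongly_nonexpansive_near C S T p y B S_strong S_NST Fp Cy yB _ d6.
  have B1 : 0 < B + 1 by rewrite ltr_wpDl.
  have eB : 0 < e / 2 / (B + 1) by rewrite divr_gt0.
  have k4 : 0 < k / 4 by rewrite divr_gt0.
  have d8 : 0 < d / 8 by rewrite divr_gt0.
  have Hak := alphaB_le _ k4; have Had := alphaB_le _ d8.
  have Hf : \forall n \near \oo, `|f n p - u| <= e / 2 / (B + 1).
    have /cvgrPdist_le/(_ _ eB) := f_cvg; apply: filterS => n.
    by rewrite distrC.
  apply: filterS2 (filterI Hk Hf) (filterI Hak Had) => n [{}Hk {}Hf] [{}Hak {}Had].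
  have /andP[a0 a1] := alpha_01 n.
  have aB0 : 0 <= alpha n * B by rewrite mulr_ge0// ltW.
  have SB := viscosity_step_image _ _ _ _ (nS n) (Cy n) Cp (Sp n).
  have fB := stepf n (yB n).
  (* A small decrease bounds the gap for [S n] by [k / 2 + alpha n * B <= k], so that [Hk]
     applies. *)
  have [small|large] := leP (`|y n - p| - `|y n.+1 - p|) (k / 2).
    have [|yS yT] := Hk.
      have := viscosity_step_dist _ _ _ _ _ p (alpha_01 n) (y_rec n).
      have := ler_wpM2l (ltW a0) fB.
      have := mulr_ge0 (ltW a0) (normr_ge0 (S n (y n) - p)).
      by lra.
    have yy : `|y n.+1 - y n| <= d / 4 + d / 6.
      have -> : y n.+1 - y n = alpha n *: (f n (y n) - S n (y n)) + (S n (y n) - y n).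
        by rewrite y_rec scalerBl scale1r scalerBr addrCA addrAC addrC.
      apply: le_trans (ler_normD _ _) _; rewrite normrZ gtr0_norm// (distrC _ (y n)).
      have : `|f n (y n) - S n (y n)| <= 2 * B.
        have := ler_distD p (f n (y n)) (S n (y n)); rewrite (distrC p).
        by have := yB n; lra.
      by move/(ler_wpM2l (ltW a0)); lra.
    have yT1 : `|y n.+1 - T (y n.+1)| <= d.
      have := ler_distD (y n) (y n.+1) (T (y n.+1)).
      have := ler_distD (T (y n)) (y n) (T (y n.+1)).
      by have := T_nonexp _ _ (Cy n) (Cy n.+1); rewrite (distrC (y n) (y n.+1)); lra.
    have Jn := Hd _ (Cy n.+1) (yB n.+1) yT1.
    apply: (viscosity_step_sqr J HJ C (common_fixed_points C S) (S n) (f n)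
      (alpha n) theta (y n) (y n.+1) p u) => //.
    have : `|y n.+1 - p| * `|f n p - u| <= (B + 1) * (e / 2 / (B + 1)).
      by apply: ler_pM => //; have := yB n.+1; lra.
    by rewrite [X in _ <= X]mulrC divfK ?gt_eqF//; rewrite -/p in Jn; lra.
  (* A decrease beyond [k / 2] outweighs the loss [c * alpha n * r], since [alpha n * B] is already
     small. *)
  have r'0 := normr_ge0 (y n.+1 - p); have r0 := normr_ge0 (y n - p).
  have rB := yB n.
  set r := `|y n - p| in large r0 rB *; set r' := `|y n.+1 - p| in large r'0 *.
  have H1 : r' ^+ 2 <= r * (r - k / 2) by rewrite expr2; apply: ler_pM => //; lra.
  have H2 : c * alpha n * r <= k / 2.
    have : c * alpha n <= alpha n by rewrite ler_piMl ?(ltW a0)// /c; lra.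
    move=> ca; have : c * alpha n * r <= alpha n * B.
      by apply: ler_pM => //; rewrite mulr_ge0 ?ltW.
    by lra.
  have := ler_wpM2l r0 H2; have := mulr_gt0 a0 e0; lra.
apply/cvgrPdist_le => e e0.
(* In [step] this value gives the error [c * alpha n * (e ^+ 2 / 2)], so the recursion lemma ends at
   [e ^+ 2]. *)
have ce0 : 0 < c * e ^+ 2 / 4 by rewrite divr_gt0// mulr_gt0// exprn_gt0.
have e20 : 0 < e ^+ 2 / 2 by rewrite divr_gt0// exprn_gt0.
have := halpern_recursion_eventually_le R (fun n => `|y n - p| ^+ 2) alpha c _ c0 e20.
have H n : 0 <= alpha n by have /andP[/ltW] := alpha_01 n.
have H' n : c * alpha n <= 1.
  by have /andP[_ a1] := alpha_01 n; rewrite mulr_ile1 ?(ltW c0)// /c; lra.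
move=> /(_ H H' (fun n => sqr_ge0 _) alpha_sum)[].
  by apply: filterS (step _ ce0) => n; lra.
move=> N _ HN; exists N => // n /HN /=.
rewrite mulrC divfK// distrC ler_pXn2r ?nnegrE//; exact: ltW.
Qed.
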